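(* Let $\mathcal{E}$ be an evolution algebra over $\mathbb{K}$. Then $\operatorname{Nil}(\mathcal{E})=\operatorname{SNil}(\mathcal{E})$ (meaning that $\mathcal{E}$ has a unique maximal nilpotent ideal and it equals $\operatorname{SNil}(\mathcal{E})$) if and only if $\operatorname{SNil}(\mathcal{E})$ is a maximal nilpotent ideal of $\mathcal{E}$.
   Context: $\mathbb{K}$ is a field of characteristic different from $2$. An evolution algebra over $\mathbb{K}$ is a finite-dimensional $\mathbb{K}$-algebra (commutative, not necessarily associative) having a basis $\{e_1,\dots,e_n\}$, called a natural basis, with $e_ie_j=0$ for $i\neq j$. For an algebra $\mathcal{A}$ put $\mathcal{A}^1=\mathcal{A}$, $\mathcal{A}^{m+1}=\sum_{i=1}^m\mathcal{A}^i\mathcal{A}^{m+1-i}$; $\mathcal{A}$ is nilpotent if $\mathcal{A}^m=0$ for some $m$, and an ideal is nilpotent if it is so as an algebra. A maximal nilpotent ideal is a nilpotent ideal not properly contained in another nilpotent ideal. If $\mathcal{E}$ has a unique maximal nilpotent ideal, it is called the nilradical and denoted $\operatorname{Nil}(\mathcal{E})$. An ideal $I$ of $\mathcal{E}$ is $\mathcal{E}$-supersolvable if there is a chain $0=I_0\subsetneq I_1\subsetneq\dots\subsetneq I_s=I$ with each $I_i$ an ideal of $\mathcal{E}$ and $\dim I_i=i$. The supersolvable nilradical $\operatorname{SNil}(\mathcal{E})$ is the largest $\mathcal{E}$-supersolvable nilpotent ideal of $\mathcal{E}$ (a largest such ideal, containing all others, exists). *)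

(* Defs.v *)
From HB Require Import structures.
From mathcomp Require Import all_boot all_algebra zify.
From mathcomp Require Import boolp classical_sets.

Set Implicit Arguments.
Unset Strict Implicit.
Unset Printing Implicit Defensive.

Import GRing.Theory.
Local Open Scope ring_scope.

(* A (not necessarily associative) finite-dimensional K-algebra is a vectType  *)
(* E together with a bilinear product mul.                                     *)
Section NonassociativeAlgebra.
Variables (K : fieldType) (E : vectType K) (mul : {bilinear E -> E -> E}).
Implicit Types (U V W I J N P Q : {vspace E}) (m n s : nat).

Definition natural_basis n (e : n.-tuple E) : Prop :=
  basis_of fullv e /\ (forall i j : 'I_n, i != j -> mul (tnth e i) (tnth e j) = 0).

Definition evolution_algebra : Prop :=
  commutative mul /\ (exists n, exists e : n.-tuple E, natural_basis e).

(* Same definition as falgebra.prodv, which assumes associativity. *)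
Definition mulv U V : {vspace E} :=
  <<[seq mul u v | u <- vbasis U, v <- vbasis V]>>%VS.

(* powseq U n = [:: U^1; ...; U^n.+1]; see powv1 and powvS below. *)
Fixpoint powseq U n : seq {vspace E} :=
  if n is n'.+1 then
    let s := powseq U n' in
    rcons s (\sum_(i < n) mulv (nth 0%VS s i) (nth 0%VS s (n' - i)))%VS
  else [:: U].

(* powv U m is U^m for 0 < m; the value at m = 0 is irrelevant. *)
Definition powv U m : {vspace E} := nth 0%VS (powseq U m.-1) m.-1.

Definition nilpotent U : Prop := exists2 m, (0 < m)%N & powv U m = 0%VS.

Definition ideal I : Prop :=
  forall x y, y \in I -> mul x y \in I /\ mul y x \in I.

Definition nilpotent_ideal I : Prop := ideal I /\ nilpotent I.

Definition maximal_nilpotent_ideal I : Prop :=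
  nilpotent_ideal I /\
  (forall J, nilpotent_ideal J -> (I <= J)%VS -> J = I).

(* N is the unique maximal nilpotent ideal, i.e. Nil(E) exists and equals N. *)
Definition is_nilradical N : Prop :=
  maximal_nilpotent_ideal N /\ (forall M, maximal_nilpotent_ideal M -> M = N).

Definition supersolvable I : Prop :=
  exists s, exists c : nat -> {vspace E},
    [/\ c 0%N = 0%VS, c s = I,
        forall i, (i < s)%N -> (c i <= c i.+1)%VS /\ c i != c i.+1
      & forall i, (i <= s)%N -> ideal (c i) /\ \dim (c i) = i].

Definition supersolvable_nilpotent_ideal I : Prop :=
  [/\ ideal I, nilpotent I & supersolvable I].

Definition largest_supersolvable_nilpotent_ideal I : Prop :=
  supersolvable_nilpotent_ideal I /\
  (forall J, supersolvable_nilpotent_ideal J -> (J <= I)%VS).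

(* The default value 0 is never used when mul is commutative: see SNilP. *)
Definition SNil : {vspace E} :=
  xget 0%VS [set I | largest_supersolvable_nilpotent_ideal I]%classic.

Lemma powv1 U : powv U 1 = U. Proof. by []. Qed.

Lemma size_powseq U n : size (powseq U n) = n.+1.
Proof. by elim: n => //= n IH; rewrite size_rcons IH. Qed.

Lemma nth_powseq U n i : (i <= n)%N -> nth 0%VS (powseq U n) i = powv U i.+1.
Proof.
elim: n => [|n IH]; first by case: i.
rewrite leq_eqVlt => /predU1P[->//|]; rewrite ltnS => le_in.
by rewrite /= nth_rcons size_powseq ltnS le_in IH.
Qed.

Lemma powvS U m : (0 < m)%N ->
  powv U m.+1 = (\sum_(1 <= i < m.+1) mulv (powv U i) (powv U (m.+1 - i)))%VS.
Proof.
case: m => // n _; rewrite big_add1 big_mkord.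
rewrite [LHS]/powv /= nth_rcons size_powseq ltnn eqxx.
apply: eq_bigr => i _; have le_in : (i <= n)%N by rewrite -ltnS.
by rewrite !nth_powseq ?leq_subr // subSS subSn.
Qed.

Lemma memv_mulv U V u v : u \in U -> v \in V -> mul u v \in mulv U V.
Proof.
move=> /coord_vbasis-> /coord_vbasis->.
rewrite linear_sumlz; apply: memv_suml => i _.
rewrite linear_sumr; apply: memv_suml => j _.
rewrite linearZl_LR linearZr_LR !memvZ // memv_span //.
by apply/allpairsP; exists ((vbasis U)`_i, (vbasis V)`_j); rewrite !memt_nth.
Qed.

Lemma mulvP U V W :
  reflect (forall u v, u \in U -> v \in V -> mul u v \in W) (mulv U V <= W)%VS.
Proof.
apply: (iffP idP) => [sUVW u v Uu Vv | sUVW].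
  by rewrite (subvP sUVW) ?memv_mulv.
apply/span_subvP=> _ /allpairsP[[u v] /= [Uu Vv ->]].
by rewrite sUVW ?vbasis_mem.
Qed.

Lemma mulvS U1 U2 V1 V2 :
  (U1 <= U2 -> V1 <= V2 -> mulv U1 V1 <= mulv U2 V2)%VS.
Proof.
by move=> /subvP sU /subvP sV; apply/mulvP=> u v /sU Uu /sV; apply: memv_mulv.
Qed.

Lemma powvS_sub U W m : (0 < m)%N ->
  (forall i j, (0 < i)%N -> (0 < j)%N -> (i + j)%N = m.+1 ->
     (mulv (powv U i) (powv U j) <= W)%VS) ->
  (powv U m.+1 <= W)%VS.
Proof.
move=> m0 H; rewrite powvS // big_nat.
elim/big_ind: _ => [|A B AW BW|i /andP[i0 im]]; first exact: sub0v.
  by rewrite subv_add AW.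
by apply: H => //; rewrite ?subn_gt0 // subnKC // ltnW.
Qed.

Lemma mulv_powv U i j : (0 < i)%N -> (0 < j)%N ->
  (mulv (powv U i) (powv U j) <= powv U (i + j))%VS.
Proof.
move=> i0 j0; rewrite -[(i + j)%N]prednK ?addn_gt0 ?i0 // powvS; last first.
  by case: i i0 j0 => // i _; case: j => // j _; rewrite addnS.
have ltij : (i < (i + j).-1.+1)%N by rewrite prednK ?addn_gt0 ?i0 // -addn1 leq_add2l.
rewrite (@bigD1_seq _ _ _ _ _ i) ?mem_index_iota ?i0 ?iota_uniq //=.
by rewrite prednK ?addn_gt0 ?i0 // addKn addvSl.
Qed.

Lemma powv_decr I m : ideal I -> (0 < m)%N -> (powv I m.+1 <= powv I m)%VS.
Proof.
move=> idI; elim/ltn_ind: m => m IH m0; apply: powvS_sub => // i j i0 j0 ijm.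
case: (ltnP 1 i) => i1.
  have -> : m = (i.-1 + j)%N by lia.
  apply: subv_trans (mulv_powv I _ _); rewrite ?mulvS ?subvv //; last by lia.
  by rewrite -{1}[i]prednK //; apply: IH; lia.
have {i0 i1}i1 : i = 1%N by lia.
case: (ltnP 1 j) => j1.
  have -> : m = (i + j.-1)%N by lia.
  apply: subv_trans (mulv_powv I _ _); rewrite ?mulvS ?subvv //; try lia.
  by rewrite -{1}[j]prednK //; apply: IH; lia.
have -> : m = 1%N by lia.
have {j0 j1}-> : j = 1%N by lia.
by rewrite i1 powv1; apply/mulvP => u v _ /(idI u)[].
Qed.

Lemma powv_anti I m n : ideal I -> (0 < m <= n)%N -> (powv I n <= powv I m)%VS.
Proof.
move=> idI /andP[m0 /subnKC<-]; elim: (n - m)%N => [|k IH].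
  by rewrite addn0 subvv.
by rewrite addnS (subv_trans _ IH) ?powv_decr // addn_gt0 m0.
Qed.

Lemma ideal0 : ideal 0%VS.
Proof. by move=> x y; rewrite memv0 => /eqP->; rewrite linear0l linear0r mem0v. Qed.

Lemma idealD I J : ideal I -> ideal J -> ideal (I + J)%VS.
Proof.
move=> idI idJ x _ /memv_addP[a Ia [b Jb ->]].
have [? ?] := idI x a Ia; have [? ?] := idJ x b Jb.
by rewrite linearDl linearDr !memv_add.
Qed.

Lemma nilpotent_act N P Q x u : nilpotent_ideal N -> ideal P -> ideal Q ->
  (P <= Q)%VS -> (\dim Q <= (\dim P).+1)%N ->
  x \in N -> u \in Q -> mul x u \in P.
Proof.
move=> [idN [m m0 Nm]] idP idQ sPQ dimQ Nx Qu.
case uP: (u \in P); first by have [] := idP x u uP.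
have defQ : Q = (P + <[u]>)%VS.
  apply/esym/eqP; rewrite eqEdim subv_add sPQ -memvE Qu /=.
  apply: leq_trans dimQ _; rewrite ltnNge; apply/negP => le.
  have /eqP eq : P == (P + <[u]>)%VS by rewrite eqEdim addvSl.
  by move: uP; rewrite eq (subvP (addvSr _ _)) ?memv_line.
have := (idQ x u Qu).1; rewrite {1}defQ => /memv_addP[p Pp [_ /vlineP[l ->] Exu]].
have [l0|l0] := eqVneq l 0; first by rewrite Exu l0 scale0r addr0.
suff : u \in (powv N m + P)%VS by rewrite Nm add0v uP.
have uE : u = l^-1 *: (mul x u - p) by rewrite Exu addrC addKr scalerA mulVf ?scale1r.
elim: m m0 {Nm} => // -[_ _|m IH _].
  by rewrite uE memvZ // memv_add ?rpredN // powv1; have [] := idN u x Nx.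
have /memv_addP[a Na [b Pb eu]] := IH isT.
rewrite uE memvZ // {1}eu linearDr -addrA memv_add //; last first.
  by rewrite rpredB //; have [] := idP x b Pb.
by rewrite -[m.+2]add1n (subvP (mulv_powv N _ _)) // memv_mulv.
Qed.

Hypothesis mulC : commutative mul.

Lemma nilpotentD I N : ideal I -> nilpotent I -> supersolvable I ->
  nilpotent_ideal N -> nilpotent (I + N)%VS.
Proof.
move=> idI nilI [s [c [c0 cs clt cid]]] nilN; have [idN [m m0 Nm]] := nilN.
set A := (I + N)%VS; have idA : ideal A by apply: idealD.
have base j : (0 < j)%N -> (powv A j <= I + powv N j)%VS.
  elim/ltn_ind: j => -[//|[|j]] IH _; first by rewrite !powv1.
  apply: powvS_sub => // i k i0 k0 ikj; apply/mulvP => u v.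
  move=> /(subvP (IH i _ i0)) Hu /(subvP (IH k _ k0)) Hv.
  have /memv_addP[a Ia [b Nb ->]] := Hu ltac:(lia).
  have /memv_addP[a' Ia' [b' Nb' ->]] := Hv ltac:(lia).
  have -> : mul (a + b) (a' + b') = mul b a' + mul a (a' + b') + mul b b'.
    by rewrite linearDl [mul b _]linearDr addrA [mul a _ + _]addrC.
  apply: memv_add; last by rewrite -ikj (subvP (mulv_powv N _ _)) // memv_mulv.
  by rewrite rpredD //; [have [] := idI b a' Ia' | have [] := idI (a' + b') a Ia].
have act k : (k < s)%N -> forall x u, x \in A -> u \in c k.+1 -> mul x u \in c k.
  move=> ks x u /memv_addP[a Ia [b Nb ->]] cu; rewrite linearDl.
  have [idk dk] := cid k (ltnW ks); have [idk1 dk1] := cid k.+1 ks.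
  have [sub _] := clt k ks.
  by rewrite rpredD //; [apply: (@nilpotent_act I _ (c k.+1)) |
    apply: (@nilpotent_act N _ (c k.+1))]; rewrite // dk dk1.
have desc k : (k <= s)%N ->
    exists2 n, (0 < n)%N & forall j, (n <= j)%N -> (powv A j <= c (s - k)%N)%VS.
  elim: k => [_|k IH ks].
    exists m => // j mj; rewrite subn0 cs.
    apply: subv_trans (base j (leq_trans m0 mj)) _.
    rewrite subv_add subvv (subv_trans (@powv_anti N m j idN _)) ?m0 //.
    by rewrite Nm sub0v.
  have [n n0 Hn] := IH (ltnW ks); exists (n + n)%N; first by rewrite addn_gt0 n0.
  case=> [|j] nj; first by lia.
  have sk : (s - k = (s - k.+1).+1)%N by lia.
  have sA i : (0 < i)%N -> (powv A i <= A)%VS.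
    by move=> i0; rewrite -[X in (_ <= X)%VS]powv1 powv_anti.
  rewrite sk in Hn; have := act (s - k.+1)%N ltac:(lia) => actk.
  apply: powvS_sub; first by lia.
  move=> i l i0 l0 il; apply/mulvP => u v iu lv.
  case: (leqP n l) => nl.
    by apply: actk; [apply: (subvP (sA i i0)) | apply: (subvP (Hn l nl))].
  rewrite mulC; apply: actk; first exact: (subvP (sA l l0)).
  by apply: (subvP (Hn i _)) => //; lia.
have [n n0 Hn] := desc s (leqnn s); exists n => //.
by apply/eqP; rewrite -subv0 -c0 -(subnn s) Hn.
Qed.

Lemma supersolvableS I J : supersolvable I -> ideal J -> (I <= J)%VS ->
  (\dim J <= (\dim I).+1)%N -> supersolvable J.
Proof.
move=> ssI idJ sIJ; rewrite leq_eqVlt => /predU1P[dJ|]; last first.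
  by rewrite ltnS => le; have /eqP<- : I == J by rewrite eqEdim sIJ.
have [s [c [c0 cs clt cid]]] := ssI.
have dI : \dim I = s by rewrite -cs; have [] := cid s (leqnn s).
exists s.+1, (fun i => if (i <= s)%N then c i else J); split => //.
- by rewrite ltnn.
- move=> i; rewrite ltnS => le; rewrite le; case: ltnP => [/clt//|le'].
  have -> : i = s by apply/eqP; rewrite eqn_leq le.
  by rewrite cs; split=> //; apply/eqP => IJ; move: dJ; rewrite IJ; lia.
- move=> i; rewrite leq_eqVlt ltnS => /predU1P[->|le]; first by rewrite ltnn dJ dI.
  by rewrite le; apply: cid.
Qed.

Lemma supersolvableD I J : ideal I -> supersolvable I -> supersolvable J ->
  supersolvable (I + J)%VS.
Proof.
move=> idI ssI [s [c [c0 cs clt cid]]]; rewrite -cs.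
elim: s {cs} clt cid => [|s IH] clt cid; first by rewrite c0 addv0.
have {IH}ss : supersolvable (I + c s)%VS.
  by apply: IH => i lt; [apply: clt | apply: cid]; apply: leqW.
have [sub _] := clt s (ltnSn s).
have [_ d] := cid s (leqnSn s); have [id1 d1] := cid s.+1 (leqnn _).
apply: supersolvableS ss _ _ _; first exact: idealD.
  exact: addvS.
have -> : (I + c s.+1 = (I + c s) + c s.+1)%VS by rewrite -addvA (addv_idPr sub).
have := dimv_sum_cap (I + c s)%VS (c s.+1).
have : (\dim (c s) <= \dim ((I + c s) :&: c s.+1))%N.
  by rewrite dimvS // subv_cap addvSr.
rewrite d d1; lia.
Qed.

Lemma SNilP : largest_supersolvable_nilpotent_ideal SNil.
Proof.
apply: xgetPex.
pose P d := exists2 I, supersolvable_nilpotent_ideal I & \dim I = d.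
have P0 : exists d, `[< P d >].
  exists 0%N; apply/asboolP; exists 0%VS; last exact: dimv0.
  split; [exact: ideal0 | by exists 1%N | exists 0%N, (fun=> 0%VS); split => //].
  by case=> // _; split; [exact: ideal0 | exact: dimv0].
have Pub d : `[< P d >] -> (d <= \dim {:E})%N.
  by move=> /asboolP[I _ <-]; rewrite dimvS ?subvf.
case: (ex_maxnP P0 Pub) => d /asboolP[I ssI dI] dmax; exists I; split => // J ssJ.
have [idI nilI sI] := ssI; have [idJ nilJ sJ] := ssJ.
have : (\dim (I + J) <= d)%N.
  apply: dmax; apply/asboolP; exists (I + J)%VS => //; split.
  - exact: idealD.
  - exact: nilpotentD.
  - exact: supersolvableD.
move=> le; have /eqP-> : I == (I + J)%VS by rewrite eqEdim addvSl dI.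
exact: addvSr.
Qed.

End NonassociativeAlgebra.

(* Main.v *)
(* Adding a supersolvable nilpotent ideal to a nilpotent ideal keeps it nilpotent.
   Hence, if SNil(E) is maximal, it absorbs every maximal nilpotent ideal M
   (as SNil(E) + M is nilpotent), and M = SNil(E) by maximality of M. *)
Require Import Defs.
From mathcomp Require Import all_boot all_algebra.

Local Open Scope ring_scope.

Theorem corollary3p17 (K : fieldType) (char_neq2 : 2%N \notin [pchar K])
    (E : vectType K) (mul : {bilinear E -> E -> E})
    (evolE : evolution_algebra mul) :
  is_nilradical mul (SNil mul) <-> maximal_nilpotent_ideal mul (SNil mul).
Proof.
split=> [[]//|maxS]; split=> // M [nilM maxM].
have [mulC _] := evolE.
(* Commutativity ensures that a largest ideal exists, so [SNil mul] has its defining properties and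
   is not merely the default of [xget]. *)
have [[idS nilS ssS] _] := SNilP mulC.
have [_ absorbS] := maxS.
have defS : (SNil mul + M)%VS = SNil mul.
  apply: absorbS (addvSl _ _); split; first exact: idealD idS nilM.1.
  (* The supersolvable summand is [SNil mul]; [M] enters as an arbitrary nilpotent ideal. *)
  exact: nilpotentD mulC _ _ idS nilS ssS nilM.
(* Here the maximality of [M] is used: [defS] puts [M] inside the nilpotent ideal [SNil mul]. *)
by apply/esym/maxM; rewrite // -defS addvSr.
Qed.
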